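(* Let $I \subset \mathbb{R}$ be a closed interval and let $f_\mu$, $\mu \in I$, be a family of smooth unimodal maps of a compact interval into itself (at least $C^2$ in phase space and $C^1$ in the parameter), such that $f_\mu$ has a unique attractor $\mathcal{A}_\mu$ at each parameter value $\mu \in I$. If there is a parameter $\mu_0 \in \mathrm{int}(I)$ at which there is a non-degenerate saddle-node bifurcation of a periodic orbit of period $k > 1$, then the attractor $\mathcal{A}_\mu$ is not continuous in the Hausdorff metric at $\mu_0$.
   Context: A smooth unimodal map is a map of a compact interval into itself with a single maximum, at a point $c$ (the critical point), increasing to the left of $c$ and decreasing to the right. Use $d(x,y)=|x-y|$; for sets $X,Y$ put $d_a(X,Y)=\sup_{x\in X}\inf_{y\in Y} d(x,y)$ and $d_H(X,Y)=\max[d_a(X,Y),d_a(Y,X)]$. Attractor: a nonempty compact set $\mathcal{A}$ of the phase interval is an attractor of $f$ if (i) $f(\mathcal{A})=\mathcal{A}$; (ii) $\mathcal{A}$ contains a dense orbit; (iii) there exists $r>0$ such that $d_a(f^n(x),\mathcal{A})\to 0$ as $n\to\infty$ for all $x$ in the phase interval within distance $r$ of $\mathcal{A}$. Non-degenerate saddle-node bifurcation of period $k$ at $\mu_0$ (standard meaning): $f_{\mu_0}$ has a periodic point $x_0$ of least period $k$ with $(f_{\mu_0}^k)'(x_0)=1$, $(f_{\mu_0}^k)''(x_0)\neq 0$ and $\frac{\partial}{\partial\mu} f_\mu^k(x_0)\big|_{\mu=\mu_0}\neq 0$; thus a pair of period-$k$ orbits, one stable and one unstable, is created as $\mu$ passes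 through $\mu_0$. Continuity of $\mathcal{A}_\mu$ in the Hausdorff metric at $\mu_0$: for all $\varepsilon>0$ there is $\delta>0$ such that $d_H(\mathcal{A}_{\mu_0},\mathcal{A}_\nu)<\varepsilon$ whenever $\nu\in I$ and $|\mu_0-\nu|<\delta$. *)

(* Defs.v *)
From HB Require Import structures.
From mathcomp Require Import all_boot all_order all_algebra.
From mathcomp Require Import all_classical all_reals all_analysis.
Set Implicit Arguments.
Unset Strict Implicit.
Unset Printing Implicit Defensive.
Import Order.TTheory GRing.Theory Num.Theory.
Import numFieldNormedType.Exports.
Local Open Scope classical_set_scope.
Local Open Scope ring_scope.

Definition dist_asym (R : realType) (X Y : set R) : R :=
  sup [set inf [set `|x - y| | y in Y] | x in X].

Definition dist_hausdorff (R : realType) (X Y : set R) : R :=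
  Num.max (dist_asym X Y) (dist_asym Y X).

(* Maps of an interval are total functions whose values outside the interval
   are irrelevant, so differentiation is relative to a set [D]: it is one-sided
   at the endpoints of an interval [D] and the usual one inside. *)
Definition diff_quotient_within (R : realType) (D : set R) (g : R -> R)
    (x : R) : set_system R :=
  (g y - g x) / (y - x) @[y --> within D x^'].

Definition derivable_within (R : realType) (D : set R) (g : R -> R) (x : R) :
    Prop :=
  cvg (diff_quotient_within D g x).

(* Meaningful only when [derivable_within D g x]. *)
Definition derive_within (R : realType) (D : set R) (g : R -> R) (x : R) : R :=
  lim (diff_quotient_within D g x).

Record unimodal (R : realType) (a b : R) (g : R -> R) : Prop := Unimodal {
  unimodal_maps : forall x, x \in `[a, b] -> g x \in `[a, b];
  unimodal_turn : exists2 c, a < c < b &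
    {in `[a, c] &, {homo g : x y / x < y >-> x < y}} /\
    {in `[c, b] &, {homo g : x y / x < y >-> y < x}}
}.

(* The partial derivatives are required to be continuous jointly in the
   parameter and the phase variable. *)
Record C2_C1_family (R : realType) (I J : set R) (f : R -> R -> R) : Prop :=
  C2C1Family {
  family_continuous :
    {within I `*` J, continuous (fun p : R * R => f p.1 p.2)};
  family_derivable_phase : forall mu x, I mu -> J x ->
    derivable_within J (f mu) x;
  family_derive_phase_continuous :
    {within I `*` J, continuous (fun p : R * R =>
       derive_within J (f p.1) p.2)};
  family_derivable2_phase : forall mu x, I mu -> J x ->
    derivable_within J (derive_within J (f mu)) x;
  family_derive2_phase_continuous :
    {within I `*` J, continuous (fun p : R * R =>
       derive_within J (derive_within J (f p.1)) p.2)};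
  family_derivable_param : forall mu x, I mu -> J x ->
    derivable_within I (fun nu => f nu x) mu;
  family_derive_param_continuous :
    {within I `*` J, continuous (fun p : R * R =>
       derive_within I (fun nu => f nu p.2) p.1)}
}.

Record attractor (R : realType) (J : set R) (g : R -> R) (A : set R) : Prop :=
  Attractor {
  attractor_sub : A `<=` J;
  attractor_nonempty : A !=set0;
  attractor_compact : compact A;
  attractor_invariant : g @` A = A;
  attractor_dense_orbit : exists x,
    let orbit := range (fun n => iter n g x) in
    orbit `<=` A /\ A `<=` closure orbit;
  attractor_attracts : exists2 r : R, 0 < r &
    forall x, J x -> dist_asym [set x] A < r ->
      dist_asym [set iter n g x] A @[n --> \oo] --> (0 : R)
}.

Definition least_period (R : realType) (g : R -> R) (k : nat) (x : R) : Prop :=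
  [/\ (0 < k)%N, iter k g x = x &
      forall j, (0 < j < k)%N -> iter j g x <> x].

Definition saddle_node (R : realType) (I J : set R) (f : R -> R -> R)
    (k : nat) (mu0 : R) : Prop :=
  exists x0, [/\ J x0,
    least_period (f mu0) k x0,
    derive_within J (iter k (f mu0)) x0 = 1,
    derive_within J (derive_within J (iter k (f mu0))) x0 <> 0 &
    derive_within I (fun mu => iter k (f mu) x0) mu0 <> 0].

Definition hausdorff_continuous_at (R : realType) (I : set R)
    (A : R -> set R) (mu0 : R) : Prop :=
  forall eps : R, 0 < eps -> exists2 delta : R, 0 < delta &
    forall nu, I nu -> `|mu0 - nu| < delta ->
      dist_hausdorff (A mu0) (A nu) < eps.

(* Main.v *)
Require Import Defs.
From HB Require Import structures.
From mathcomp Require Import all_boot all_order all_algebra.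
From mathcomp Require Import all_classical all_reals all_analysis.
From mathcomp Require Import ring lra.
Import Order.TTheory GRing.Theory Num.Theory.
Import numFieldNormedType.Exports.
Local Open Scope classical_set_scope.
Local Open Scope ring_scope.

Set Implicit Arguments.
Unset Strict Implicit.
Unset Printing Implicit Defensive.

(** Suppose the attractor were continuous at [mu0], and let [x0] be the
    saddle-node point and [G mu] the [k]-th iterate of [f mu].  On one side of
    [mu0] the bifurcation has created a stable cycle next to the cycle of [x0].
    It is an attractor, hence by uniqueness the whole attractor, so near [mu0]
    on that side [A mu] is uniformly close to the [k] points of the cycle of
    [x0].  By continuity [A mu0], and then also [A nu] for [nu] on the other
    side of [mu0], lies close to these [k] points.  But on that other side the
    graph of [G nu] has left the diagonal near [x0]: every point [x] near [x0]
    is moved by [G nu] in the same direction.  The piece of [A nu] that lies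
    near [x0] is nonempty, compact and mapped into itself by [G nu]; its
    extreme point in the direction of the drift would be moved beyond it
    ([drift_no_compact_invariant]).

    The local picture is made precise as follows.  Differentiation relative
    to a set is put in Caratheodory form, for which the chain and product
    rules give that [G] is twice differentiable in phase with jointly
    continuous derivatives ([phase_C2_iter]).  In the parameter the increment
    of [G] is [nu - mu0] times a factor that converges jointly in the
    parameter and the phase ([param_slope_iter]).  With [q] the second phase
    derivative and [L] the parameter derivative at the bifurcation, the
    displacement [G nu x - x] then behaves like
    [L * (nu - mu0) + q / 2 * (x - x0) ^+ 2]: it has a zero of multiplier less
    than [1] if [q * L * (nu - mu0) < 0]
    ([saddle_node_stable_fixpoint]) and has none near [x0], uniformly, if
    [0 < q * L * (nu - mu0)] ([saddle_node_no_fixpoint]).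

    All this takes place at an interior point of the phase interval.  Since
    [k > 1], a cycle that contains an endpoint passes through the turning
    point, where the derivative vanishes, which is incompatible with
    multiplier [1] ([periodic_point_interior]). *)

(** * Derivatives relative to a set *)

Lemma cvg_to_within {T : Type} {U : topologicalType} (F : set_system T)
    (D : set T) (E : set U) (h : T -> U) (y : U) : Filter F ->
  (\forall x \near F, D x) -> (forall x, D x -> E (h x)) ->
  h x @[x --> F] --> y -> h x @[x --> F] --> within E (nbhs y).
Proof.
move=> FF FD DE hy W EW; have := hy _ EW.
rewrite !nbhs_simpl /=; apply: filterS2 FD => x Dx WE.
by apply: WE; exact: DE.
Qed.

Lemma dnbhs_within_proper (R : realType) (D : set R) (x : R) : nbhs x D ->
  ProperFilter (within D x^').
Proof.
move=> nD; apply: Build_ProperFilter_ex => W WD.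
have {}WD : (x^')%classic [set y | D y -> W y] := WD.
have xD : (x^')%classic D by exact: nbhs_dnbhs.
by have [y [/= DW Dy]] := filter_ex (filterI WD xD); exists y; exact: DW.
Qed.

(** Caratheodory's form of [l] being the derivative of [g] at [x] relative to
    [D]: the difference quotient extends continuously to [x].  The factor [phi]
    is never divided by, so the chain rule needs no separate treatment of the
    points where the inner function repeats its value at [x]. *)
Definition caratheodory (R : realType) (D : set R) (g : R -> R) (x l : R) :=
  exists2 phi : R -> R,
    (forall y, D y -> g y - g x = phi y * (y - x)) &
    phi y @[y --> within D (nbhs x)] --> l.

Section Caratheodory.
Context {R : realType}.
Implicit Types (D E : set R) (g h : R -> R).

Lemma caratheodory_derive_within D g x :
  derivable_within D g x -> caratheodory D g x (derive_within D g x).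
Proof.
rewrite /derivable_within /derive_within => /= dg; set l : R := lim _.
exists (fun y => if y == x then l else (g y - g x) / (y - x)).
  move=> y _; case: eqP => [->|/eqP yx]; first by rewrite !subrr mulr0.
  by rewrite divfK// subr_eq0.
apply/cvgrPdist_lt => e e0.
have /cvgrPdist_lt/(_ e e0) H : diff_quotient_within D g x --> l by [].
have {}H : nbhs x [set y | y != x -> D y ->
  `|l - (g y - g x) / (y - x)| < e] := H.
apply: filterS H => y yP Dy.
case: eqP => [_|/eqP yx]; first by rewrite subrr normr0.
exact: yP.
Qed.

Lemma caratheodory_continuous D g x l :
  caratheodory D g x l -> g y @[y --> within D (nbhs x)] --> g x.
Proof.
case=> phi gphi phil.
have lim0 : g x + phi y * (y - x) @[y --> within D (nbhs x)] --> g x + l * (x -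
  x).
  apply: cvgD; first exact: cvg_cst.
  apply: cvgM => //; apply: cvgB; last exact: cvg_cst.
  exact: cvg_within.
rewrite subrr mulr0 addr0 in lim0.
apply: cvg_trans lim0; apply: near_eq_cvg.
by apply: filterS (near_withinT _ _) => y Dy; rewrite -gphi// addrC subrK.
Qed.

Lemma caratheodory_comp D E g h x l m : D x -> {homo h : y / D y >-> E y} ->
  caratheodory D h x l -> caratheodory E g (h x) m ->
  caratheodory D (g \o h) x (m * l).
Proof.
move=> Dx DE ch; have hc := caratheodory_continuous ch.
case: ch => phi hphi phil [psi gpsi psim].
exists (fun y => psi (h y) * phi y).
  by move=> y Dy /=; rewrite gpsi ?hphi ?mulrA//; exact: DE.
apply: cvgM => //; apply: cvg_comp psim.
by apply: (cvg_to_within (D := D)) => //; exact: near_withinT.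
Qed.

Lemma caratheodory_mul D g h x l m :
  caratheodory D g x l -> caratheodory D h x m ->
  caratheodory D (fun y => g y * h y) x (l * h x + g x * m).
Proof.
move=> cg ch; have hc := caratheodory_continuous ch.
case: cg => phi gphi phil; case: ch => psi hpsi psim.
exists (fun y => phi y * h y + g x * psi y).
  by move=> y Dy; have := gphi _ Dy; have := hpsi _ Dy; nra.
apply: cvgD; first exact: cvgM.
by apply: cvgM => //; exact: cvg_cst.
Qed.

Lemma caratheodory_id D x : caratheodory D id x 1.
Proof. by exists (cst 1) => [y _|]; [rewrite mul1r|exact: cvg_cst]. Qed.

Lemma caratheodory_cst D (c : R) x : caratheodory D (cst c) x 0.
Proof. by exists (cst 0) => [y _|]; [rewrite subrr mul0r|exact: cvg_cst]. Qed.

Lemma caratheodory_congr {D g h x l} : D x -> {in D, g =1 h} ->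
  caratheodory D g x l -> caratheodory D h x l.
Proof.
move=> Dx gh [phi gphi phil]; exists phi => // y Dy.
by rewrite -!gh ?inE// gphi.
Qed.

(** Properness of the punctured filter says that [x] is a limit point of [D],
    which is what makes the derivative relative to [D] unique. *)
Lemma derive_within_caratheodory D g x l : ProperFilter (within D x^') ->
  caratheodory D g x l -> derive_within D g x = l.
Proof.
move=> PF [phi gphi phil]; rewrite /derive_within.
apply/cvg_lim => //; rewrite /diff_quotient_within.
have phi' : phi y @[y --> within D x^'] --> l.
  apply: cvg_trans phil; apply: cvg_app => W WD.
  have {}WD : nbhs x [set y | D y -> W y] := WD.
  have : nbhs x [set y | y != x -> D y -> W y] by apply: filterS WD => y WD _.
  by move=> H; exact: H.
apply: cvg_trans phi'; apply: near_eq_cvg.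
have : nbhs x [set y | y != x -> D y -> phi y = (g y - g x) / (y - x)].
  by near=> y => yx Dy; rewrite gphi// mulfK// subr_eq0.
by move=> H; exact: H.
Unshelve. all: by end_near. Qed.

Lemma caratheodory_is_derive D g x l : nbhs x D -> caratheodory D g x l ->
  is_derive x 1 g l.
Proof.
move=> nD [phi gphi phil].
have phi' : phi y @[y --> x] --> l by rewrite within_interior in phil.
have hx : h + x @[h --> 0^'] --> x.
  rewrite -[X in _ --> X]add0r; apply: cvgD; last exact: cvg_cst.
  exact: cvg_within.
have phi0 : phi (h + x) @[h --> 0^'] --> l by exact: cvg_comp hx phi'.
have H : h^-1 *: (g (h *: 1 + x) - g x) @[h --> 0^'] --> l.
  apply: cvg_trans phi0; apply: near_eq_cvg; near=> h.
  have h0 : h != 0 by near: h; exact: nbhs_dnbhs_neq.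
  have Dh : D (h + x) by near: h; exact: hx _ nD.
  rewrite [h *: 1]mulr1 gphi//.
  by rewrite addrK /GRing.scale/= mulrCA mulVf// mulr1.
apply: DeriveDef; first by apply/cvg_ex; exists l.
by rewrite /derive; apply/cvg_lim.
Unshelve. all: by end_near. Qed.

End Caratheodory.

(** * The mean value theorem relative to an interval *)

Section MeanValue.
Context {R : realType}.
Implicit Types (D : set R) (g dg : R -> R).

Lemma mean_value_within D g dg x y : is_interval D -> D x -> D y ->
  (forall z, D z -> caratheodory D g z (dg z)) ->
  exists t, [/\ 0 < t < 1, D (x + t * (y - x)) &
    g y - g x = dg (x + t * (y - x)) * (y - x)].
Proof.
move=> Ditv + + gdg; wlog: x y / x <= y => [wlg Dx Dy|].
  case: (leP x y) => [xy|/ltW yx]; first exact: wlg.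
  have [t [t01 Dt gt]] := wlg _ _ yx Dy Dx.
  have e : y + t * (x - y) = x + (1 - t) * (y - x) by ring.
  exists (1 - t); rewrite -e; split => //; first by lra.
  by rewrite -[g y - g x]opprB gt -mulrN opprB.
rewrite le_eqVlt => /predU1P[<- Dx _|xy Dx Dy].
  exists 2^-1; rewrite !subrr !mulr0 addr0; split => //; lra.
have Dxy z : x <= z <= y -> D z by exact: Ditv.
have cg : {within `[x, y], continuous g}.
  apply: (@continuous_subspaceW _ _ _ D); first by move=> z /=;
    rewrite in_itv/=; exact: Dxy.
  by apply/subspace_continuousP => z Dz;
    exact: caratheodory_continuous (gdg _ Dz).
have dxy z : z \in `]x, y[ -> is_derive z 1 g (dg z).
  move=> zxy; apply: (@caratheodory_is_derive _ D).
    near=> w; apply: Dxy.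
    suff : w \in `]x, y[ by rewrite in_itv/= => /andP[/ltW -> /ltW ->].
    by near: w; exact: near_in_itvoo.
  by apply: gdg; apply: Dxy; move: zxy;
    rewrite in_itv/= => /andP[/ltW -> /ltW ->].
have [z zxy gz] := MVT xy dxy cg.
have yx0 : y - x != 0 by rewrite subr_eq0 gt_eqF.
exists ((z - x) / (y - x)); rewrite divfK// (_ : x + (z - x) = z); last by ring.
move: zxy; rewrite in_itv/= => /andP[xz zy]; split => //.
  by rewrite divr_gt0 ?subr_gt0//= ltr_pdivrMr ?subr_gt0// mul1r ltrD2r.
by apply: Dxy; rewrite !ltW.
Unshelve. all: by end_near. Qed.

Lemma mean_value_between D g dg x y : is_interval D ->
  D x -> D y -> (forall z, D z -> caratheodory D g z (dg z)) -> x < y ->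
  exists z, [/\ x < z < y, D z & g y - g x = dg z * (y - x)].
Proof.
move=> Ditv Dx Dy gd xy.
have [t [/andP[t0 t1] Dt gt]] := mean_value_within Ditv Dx Dy gd.
have d0 : 0 < y - x by rewrite subr_gt0.
exists (x + t * (y - x)); split => //; rewrite ltrDl mulr_gt0//=.
by rewrite -ltrBrDl gtr_pMl.
Qed.

(** Along a filter on which both endpoints [u t] and [v t] converge to [c], the
    quotient of the increment of [g t] between them converges to the limit
    of the derivatives: by the mean value theorem it is a derivative at a point
    between the two.  The function [g t] may itself vary with [t], which allows
    the increments in the parameter and in the phase to be treated alike. *)
Lemma mean_slope {T : Type} (F : set_system T) D (g dg : T -> R -> R)
    (u v : T -> R) (c l : R) : Filter F -> is_interval D ->
  (\forall t \near F, [/\ D (u t), D (v t) &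
     forall z, D z -> caratheodory D (g t) z (dg t z)]) ->
  u t @[t --> F] --> c -> v t @[t --> F] --> c ->
  dg q.1 q.2 @[q --> filter_prod F (within D (nbhs c))] --> l ->
  exists2 phi : T -> R,
    (forall t, g t (u t) - g t (v t) = phi t * (u t - v t)) &
    phi t @[t --> F] --> l.
Proof.
move=> FF Ditv FD uc vc dgl.
exists (fun t => if u t == v t then l else (g t (u t) - g t (v t)) / (u t - v
  t)).
  move=> t; case: eqP => [->|/eqP uv]; first by rewrite !subrr mulr0.
  by rewrite divfK// subr_eq0.
apply/cvgrPdist_lt => e e0.
have /cvgrPdist_lt/(_ e e0)[[/= P Q] [FP DQ] PQ] := dgl.
have {}DQ : nbhs c [set z | D z -> Q z] := DQ.
move/nbhs_ballP : DQ => [d/= d0 dQ].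
have /cvgrPdist_lt/(_ d d0) ud := uc.
have /cvgrPdist_lt/(_ d d0) vd := vc.
near=> t.
case: eqP => [_|/eqP uv]; first by rewrite subrr normr0.
have [Du Dv gdg] : [/\ D (u t), D (v t) &
     forall z, D z -> caratheodory D (g t) z (dg t z)] by near: t.
have [s [s01 Ds ->]] := mean_value_within Ditv Dv Du gdg.
rewrite mulfK ?subr_eq0//.
apply: (PQ (t, _)); split => /=; first by near: t.
apply: dQ => //; rewrite /ball/=.
have udt : `|c - u t| < d by near: t.
have vdt : `|c - v t| < d by near: t.
have -> : c - (v t + s * (u t - v t)) = s * (c - u t) + (1 - s) * (c - v t).
  by ring.
move: s01 => /andP[s0 s1]; have s1' : 0 < 1 - s by rewrite subr_gt0.
rewrite (le_lt_trans (ler_normD _ _))// !normrM (gtr0_norm s0) (gtr0_norm s1').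
rewrite [ltRHS](_ : d = s * d + (1 - s) * d); last by ring.
by apply: ltrD; rewrite ltr_pM2l.
Unshelve. all: by end_near. Qed.

End MeanValue.

(** * Families twice differentiable in the phase *)

Section PhaseC2.
Context {R : realType} (I J : set R).
Implicit Types h k f : R -> R -> R.

Local Notation near_in mu x := (within (I `*` J) (nbhs (mu, x))).

Definition jointly_continuous h := forall mu x, I mu -> J x ->
  h p.1 p.2 @[p --> near_in mu x] --> h mu x.

Lemma jointly_continuous_within h :
  {within I `*` J, continuous (fun p : R * R => h p.1 p.2)} ->
  jointly_continuous h.
Proof. by move=> /subspace_continuousP H mu x Imu Jx; exact: (H (mu, x)). Qed.

Record phase_C2 h h1 h2 := PhaseC2 {
  phase_C2_derive : forall mu x, I mu -> J x ->
    caratheodory J (h mu) x (h1 mu x);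
  phase_C2_derive2 : forall mu x, I mu -> J x ->
    caratheodory J (h1 mu) x (h2 mu x);
  phase_C2_continuous : jointly_continuous h;
  phase_C2_derive_continuous : jointly_continuous h1;
  phase_C2_derive2_continuous : jointly_continuous h2 }.

Definition maps_phase h := forall mu x, I mu -> J x -> J (h mu x).

(** This is what lets limits at [(mu, k mu x)] be pulled back to limits at
    [(mu, x)] when families are composed fibrewise. *)
Lemma cvg_graph k mu x : I mu -> J x -> maps_phase k -> jointly_continuous k ->
  (p.1, k p.1 p.2) @[p --> near_in mu x] --> near_in mu (k mu x).
Proof.
move=> Imu Jx kJ kc; apply: (cvg_to_within (D := I `*` J)).
- exact: near_withinT.
- by move=> [nu y] [/= Inu Jy]; split => //=; exact: kJ.
- apply: (cvg_pair (G := nbhs mu) (H := nbhs (k mu x))); last exact: kc.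
  apply: cvg_trans (@cvg_fst _ _ (nbhs mu) (nbhs x) _).
  by apply: cvg_app; exact: cvg_within.
Qed.

Lemma jointly_continuous_comp h k : maps_phase k ->
  jointly_continuous h -> jointly_continuous k ->
  jointly_continuous (fun mu x => h mu (k mu x)).
Proof.
move=> kJ hc kc mu x Imu Jx.
exact: cvg_comp (cvg_graph Imu Jx kJ kc) (hc _ _ Imu (kJ _ _ Imu Jx)).
Qed.

Lemma phase_C2_comp h h1 h2 k k1 k2 : maps_phase k ->
  phase_C2 h h1 h2 -> phase_C2 k k1 k2 ->
  phase_C2 (fun mu x => h mu (k mu x))
    (fun mu x => h1 mu (k mu x) * k1 mu x)
    (fun mu x => h2 mu (k mu x) * k1 mu x * k1 mu x + h1 mu (k mu x) * k2 mu x).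
Proof.
move=> kJ [hd1 hd2 hc h1c h2c] [kd1 kd2 kc k1c k2c].
have h1k := jointly_continuous_comp kJ h1c kc.
have h2k := jointly_continuous_comp kJ h2c kc.
split.
- move=> mu x Imu Jx; apply: caratheodory_comp (kd1 _ _ Imu Jx) _ => //.
    by move=> y; exact: kJ.
  by apply: hd1 => //; exact: kJ.
- move=> mu x Imu Jx; apply: caratheodory_mul; last exact: kd2.
  apply: caratheodory_comp (kd1 _ _ Imu Jx) _ => //.
    by move=> y; exact: kJ.
  by apply: hd2 => //; exact: kJ.
- exact: jointly_continuous_comp.
- by move=> mu x Imu Jx; apply: cvgM; [exact: h1k|exact: k1c].
- move=> mu x Imu Jx; apply: cvgD; apply: cvgM; first 1 last.
  + exact: k1c.
  + exact: h1k.
  + exact: k2c.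
  + by apply: cvgM; [exact: h2k|exact: k1c].
Qed.

Lemma phase_C2_iter f f1 f2 n : maps_phase f -> phase_C2 f f1 f2 ->
  exists h1 h2, phase_C2 (fun mu => iter n (f mu)) h1 h2.
Proof.
move=> fJ fC2; elim: n => [|n [h1 [h2 IH]]].
  exists (fun=> cst 1), (fun=> cst 0); split => /=.
  - by move=> mu x _ _; exact: caratheodory_id.
  - by move=> mu x _ _; exact: caratheodory_cst.
  - move=> mu x _ _; apply: cvg_trans (@cvg_snd _ _ (nbhs mu) (nbhs x) _).
    by apply: cvg_app; exact: cvg_within.
  - by move=> mu x _ _; exact: cvg_cst.
  - by move=> mu x _ _; exact: cvg_cst.
do 2 eexists; apply: phase_C2_comp fC2 IH.
by move=> mu x Imu Jx; elim: n => //= n; exact: fJ.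
Qed.

(** Differentiability in the parameter at [mu0], uniformly in the phase: the
    difference quotient converges jointly as the parameter tends to [mu0] and
    the phase to [x0].  The partial derivative at [x0] alone would not
    determine how [h nu x] moves on a whole neighbourhood of [x0]. *)
Definition param_slope h (mu0 x0 L : R) :=
  exists2 psi : R * R -> R,
    (forall p, I p.1 -> J p.2 ->
       h p.1 p.2 - h mu0 p.2 = psi p * (p.1 - mu0)) &
    psi p @[p --> near_in mu0 x0] --> L.

Lemma param_slope_caratheodory h mu0 x0 L : I mu0 -> J x0 ->
  param_slope h mu0 x0 L -> caratheodory I (h^~ x0) mu0 L.
Proof.
move=> Imu0 Jx0 [psi hpsi psiL]; exists (fun nu => psi (nu, x0)).
  by move=> nu Inu; exact: (hpsi (nu, x0)).
apply: cvg_comp psiL; apply: (cvg_to_within (D := I)).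
- exact: near_withinT.
- by move=> nu Inu.
- apply: (cvg_pair (G := nbhs mu0) (H := nbhs x0)); last exact: cvg_cst.
  exact: cvg_within.
Qed.

Lemma param_slope_derivable h hm mu0 x0 : is_interval I -> I mu0 -> J x0 ->
  (forall mu x, I mu -> J x -> caratheodory I (h^~ x) mu (hm mu x)) ->
  jointly_continuous hm -> param_slope h mu0 x0 (hm mu0 x0).
Proof.
move=> Iitv Imu0 Jx0 hd hmc.
have [] := @mean_slope _ _ (near_in mu0 x0) I (fun p nu => h nu p.2)
  (fun p nu => hm nu p.2) fst (cst mu0) mu0 (hm mu0 x0) => //.
- apply: (@filterS _ (near_in mu0 x0) _ (I `*` J)); last exact: withinT.
  by move=> -[nu x] [/= Inu Jx]; split => // z Iz; exact: hd.
- apply: cvg_trans (@cvg_fst _ _ (nbhs mu0) (nbhs x0) _).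
  by apply: cvg_app; exact: cvg_within.
- exact: cvg_cst.
- apply: (@cvg_comp _ _ _ (fun q : (R * R) * R => (q.2, q.1.2)) (fun p =>
    hm p.1 p.2)); last exact: hmc.
  apply: (cvg_to_within (D := [set q | I q.2 /\ J q.1.2])) => //.
    exists (I `*` J, I); first by split; exact: withinT.
    by move=> [[nu x] mu] [/= [_ Jx] Imu].
  apply: (cvg_pair (G := nbhs mu0) (H := nbhs x0)).
    by apply: cvg_trans (cvg_within _) => W; exact: cvg_snd.
  apply: (@cvg_comp _ _ _ fst snd _ (near_in mu0 x0)); first exact: cvg_fst.
  apply: cvg_trans (@cvg_snd _ _ (nbhs mu0) (nbhs x0) _).
  by apply: cvg_app; exact: cvg_within.
by move=> phi hphi phil; exists phi => // p _ _; exact: hphi.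
Qed.

(** The increment of the composite splits into that of [h] at the moving point
    [k mu x] and that of [h mu0] between [k mu0 x] and [k mu x]; [mean_slope]
    turns the second into a multiple of the increment of [k]. *)
Lemma param_slope_comp h h1 k mu0 x0 L M : is_interval J -> I mu0 -> J x0 ->
  maps_phase k -> jointly_continuous k ->
  (forall x, J x -> caratheodory J (h mu0) x (h1 mu0 x)) ->
  jointly_continuous h1 ->
  param_slope h mu0 (k mu0 x0) L -> param_slope k mu0 x0 M ->
  param_slope (fun mu x => h mu (k mu x)) mu0 x0 (L + h1 mu0 (k mu0 x0) * M).
Proof.
move=> Jitv Imu0 Jx0 kJ kc hd h1c [psi hpsi psiL] [chi kchi chiM].
have [] := @mean_slope _ _ (near_in mu0 x0) J (fun=> h mu0)
  (fun=> h1 mu0) (fun p => k p.1 p.2) (fun p => k mu0 p.2) (k mu0 x0)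
  (h1 mu0 (k mu0 x0)) => //.
- apply: (@filterS _ (near_in mu0 x0) _ (I `*` J)); last exact: withinT.
  by move=> -[nu x] [/= Inu Jx]; split => //; exact: kJ.
- exact: kc.
- apply: (@cvg_comp _ _ _ (fun q : R * R => (mu0, q.2)) (fun p => k p.1 p.2));
    last exact: kc.
  apply: (cvg_to_within (D := I `*` J)) => //; first exact: near_withinT.
    by move=> [nu x] [].
  apply: (cvg_pair (G := nbhs mu0) (H := nbhs x0)); first exact: cvg_cst.
  apply: cvg_trans (@cvg_snd _ _ (nbhs mu0) (nbhs x0) _).
  by apply: cvg_app; exact: cvg_within.
- apply: (@cvg_comp _ _ _ (fun q : (R * R) * R => (mu0, q.2)) (fun p =>
    h1 p.1 p.2)); last by apply: h1c => //; exact: kJ.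
  apply: (cvg_to_within (D := [set q | J q.2])) => //.
    exists (setT, J); first by split; [exact: filterT|exact: withinT].
    by move=> [p x] [].
  apply: (cvg_pair (G := nbhs mu0) (H := nbhs (k mu0 x0))).
    exact: cvg_cst.
  by apply: cvg_trans (cvg_within _) => W; exact: cvg_snd.
move=> phi hphi phil.
exists (fun p => psi (p.1, k p.1 p.2) + phi p * chi p).
  move=> p Ip Jp; rewrite mulrDl -mulrA -kchi// -hphi -(hpsi (p.1, _))//=;
    last exact: kJ.
  ring.
apply: cvgD; last exact: cvgM.
by apply: cvg_comp psiL; exact: cvg_graph.
Qed.

Lemma param_slope_iter f f1 f2 fm mu0 x0 n : is_interval I -> is_interval J ->
  I mu0 -> J x0 -> maps_phase f -> phase_C2 f f1 f2 ->
  (forall mu x, I mu -> J x -> caratheodory I (f^~ x) mu (fm mu x)) ->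
  jointly_continuous fm ->
  exists L, param_slope (fun mu => iter n (f mu)) mu0 x0 L.
Proof.
move=> Iitv Jitv Imu0 Jx0 fJ fC2 fd fmc.
have itJ m : maps_phase (fun mu => iter m (f mu)).
  by move=> mu x Imu Jx; elim: m => //= m; exact: fJ.
elim: n => [|n [L IH]].
  by exists 0, (cst 0) => [p _ _ /=|]; [rewrite subrr mul0r|exact: cvg_cst].
have [h1 [h2 itC2]] := phase_C2_iter n fJ fC2.
eexists; apply: (param_slope_comp (h := f)) IH => //.
- exact: phase_C2_continuous itC2.
- by move=> x Jx; apply: (phase_C2_derive fC2).
- exact: phase_C2_derive_continuous fC2.
- apply: (param_slope_derivable (hm := fm)) => //; exact: (itJ n).
Qed.

End PhaseC2.

(** * Unimodal maps of a segment *)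

Section Segment.
Context {R : realType} (a b : R) (ltab : a < b).
Local Notation J := `[a, b].
Implicit Types g : R -> R.

Lemma segmentP x : [set` J] x <-> a <= x <= b.
Proof. by rewrite /= in_itv/=. Qed.

Lemma within_segment_proper x : [set` J] x -> ProperFilter (within [set` J]
  x^').
Proof.
move=> /segmentP/andP[ax xb]; apply: Build_ProperFilter_ex => W WJ.
have {}WJ : nbhs x [set y | y != x -> [set` J] y -> W y] := WJ.
move/nbhs_ballP : WJ => [d /= d0 dW].
have [ltxb|lebx] := ltP x b.
  exists (Num.min b (x + d / 2)); apply: dW.
  - rewrite /ball/= distrC ger0_norm ?subr_ge0 ?le_min ?xb ?lerDl ?divr_ge0
      ?ltW//.
    by rewrite ltrBlDl gt_min; apply/orP; right; lra.
  - by rewrite gt_eqF// lt_min ltxb/=; lra.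
  - by apply/segmentP; rewrite le_min ge_min lexx ltW//=; lra.
have ltax : a < x by exact: lt_le_trans ltab _.
exists (Num.max a (x - d / 2)); apply: dW.
- rewrite /ball/= ger0_norm ?subr_ge0 ?ge_max ?ax ?lerBlDr ?lerDl ?divr_ge0
    ?ltW//.
  by rewrite ltrBlDl -ltrBlDr lt_max; apply/orP; right; lra.
- by rewrite lt_eqF// gt_max ltax/=; lra.
- by apply/segmentP; rewrite ge_max le_max lexx (ltW ltab) /=; lra.
Qed.

Lemma segment_derive_within g x l : [set` J] x -> caratheodory [set` J] g x l ->
  derive_within [set` J] g x = l.
Proof. by move=> Jx; apply: derive_within_caratheodory;
  exact: within_segment_proper. Qed.

Lemma caratheodory_unique g x l m : [set` J] x ->
  caratheodory [set` J] g x l -> caratheodory [set` J] g x m -> l = m.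
Proof.
by move=> Jx gl gm; rewrite -(segment_derive_within Jx gl)
  (segment_derive_within Jx gm).
Qed.

Section Unimodal.
Context (g dg : R -> R) (gU : unimodal a b g).
Hypothesis gd : forall x, [set` J] x -> caratheodory [set` J] g x (dg x).

Lemma iter_segment n x : [set` J] x -> [set` J] (iter n g x).
Proof. by move=> Jx; elim: n => //= n; exact: unimodal_maps. Qed.

Lemma iter_caratheodory n x : [set` J] x ->
  exists l, caratheodory [set` J] (iter n g) x l.
Proof.
move=> Jx; elim: n => [|n [l IH]]; first by exists 1; exact: caratheodory_id.
exists (dg (iter n g x) * l); apply: (caratheodory_comp _ _ IH) => //.
  by move=> y; exact: iter_segment.
by apply: gd; exact: iter_segment.
Qed.

Lemma unimodal_turning_point : exists2 c, a < c < b &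
  forall x, [set` J] x -> x != c -> g x < g c.
Proof.
have [c acb [inc dec]] := unimodal_turn gU; exists c => // x /segmentP axb xc.
have [ac cb] := andP acb; have [ax xb] := andP axb.
have [xlc|clx|xec] := ltgtP x c; last by rewrite xec eqxx in xc.
- by apply: inc => //; rewrite in_itv/= ?ax ?lexx ?ltW.
- by apply: dec => //; rewrite in_itv/= ?xb ?lexx ?ltW.
Qed.

Lemma turning_point_derive c : a < c < b ->
  (forall x, [set` J] x -> x != c -> g x < g c) -> dg c = 0.
Proof.
move=> acb cmax.
have interior x : x \in `]a, b[ -> is_derive x 1 g (dg x).
  move=> xab; have xJ : [set` J] x.
    by apply/segmentP; move: xab; rewrite in_itv/= => /andP[/ltW -> /ltW ->].
  apply: caratheodory_is_derive (gd xJ).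
  near=> y; apply/segmentP.
  suff : y \in `]a, b[ by rewrite in_itv/= => /andP[/ltW -> /ltW ->].
  by near: y; exact: near_in_itvoo.
have cab : c \in `]a, b[ by rewrite in_itv.
have [_ <-] := interior _ cab.
apply: (@derive_val _ _ _ _ _ _ _ (@derive1_at_max _ _ _ _ _ (ltW ltab) _ cab
  _)).
- by move=> t /interior[].
- move=> t; rewrite in_itv/= => /andP[/ltW at_ /ltW tb].
  have [->//|tc] := eqVneq t c.
  by apply/ltW/cmax => //; apply/segmentP; rewrite at_.
Unshelve. all: by end_near. Qed.

(** By the chain rule the derivative at the turning point is a factor of the
    derivative of the iterate. *)
Lemma orbit_through_turning_point c n j x : a < c < b ->
  (forall x, [set` J] x -> x != c -> g x < g c) -> [set` J] x ->
  (j < n)%N -> iter j g x = c -> caratheodory [set` J] (iter n g) x 0.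
Proof.
move=> acb cmax Jx jn xc.
have [l jl] := iter_caratheodory j Jx.
have [m nm] := iter_caratheodory (n - j.+1) (iter_segment j.+1 Jx).
rewrite -[n in iter n](subnK jn) -[0](mulr0 m).
have gj : caratheodory [set` J] (iter j.+1 g) x 0.
  rewrite -[0](mul0r l) -(turning_point_derive acb cmax) -xc.
  apply: (caratheodory_comp _ _ jl) => //; first by move=> y;
    exact: iter_segment.
  by apply: gd; exact: iter_segment.
apply: (caratheodory_congr (g := iter (n - j.+1) g \o iter j.+1 g)) => //.
  by move=> y _; rewrite iterD.
by apply: (caratheodory_comp _ _ gj nm) => // y; exact: (iter_segment j.+1).
Qed.

(** The right endpoint can only be the image of the turning point.  The left
    one can only be the image of an endpoint: of itself, and then the period is
    [1], or of the right endpoint.  So an endpoint on the cycle puts the turning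
    point on it, and the multiplier would be [0]. *)
Lemma periodic_point_interior k x : (1 < k)%N -> [set` J] x ->
  least_period g k x -> caratheodory [set` J] (iter k g) x 1 -> a < x < b.
Proof.
move=> k1 Jx [k0 xk xj] k_1.
have [c acb cmax] := unimodal_turning_point.
have orbit_c j : (j < k)%N -> iter j g x <> c.
  move=> jk xc; have := orbit_through_turning_point acb cmax Jx jk xc.
  by move/(caratheodory_unique Jx k_1)/eqP; rewrite oner_eq0.
have [ax xb] := andP (proj1 (segmentP x) Jx).
have Jc : [set` J] c by apply/segmentP; case/andP: acb => /ltW -> /ltW ->.
have pre_b j : (j.+1 < k.+1)%N -> iter j.+1 g x <> b.
  move=> jk xjb; have Jy := iter_segment j Jx.
  have := cmax _ Jy; rewrite -[g _]/(iter j.+1 g x) xjb => /(_ _)/lt_le_trans.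
  have /segmentP/andP[_ gcb] := unimodal_maps gU Jc.
  move=> /(_ _ _ gcb); rewrite ltxx => H.
  by apply: (orbit_c j jk); apply/eqP; apply: contraT => /H.
case: k k1 {k0} xk xj k_1 orbit_c pre_b => [//|[//|k]] _ xk xj _ orbit_c pre_b.
have xltb : x < b by rewrite lt_neqAle xb andbT; apply/eqP; rewrite -xk;
  exact: pre_b.
rewrite xltb andbT lt_neqAle ax andbT; apply/eqP => axE.
set y := iter k.+1 g x.
have gy : g y = a by rewrite axE -[in RHS]xk.
have Jy : [set` J] y by exact: iter_segment.
have yb : y <> b by exact: pre_b.
have [yE|ya] := eqVneq y a.
  apply: (xj 1%N) => //=; by rewrite -axE -yE gy.
(* An interior point is mapped strictly above the image of an endpoint. *)
have [c' /andP[ac cb] [inc dec]] := unimodal_turn gU.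
have /segmentP/andP[ay yb'] := Jy.
have ltay : a < y by rewrite lt_neqAle eq_sym ya.
have ltyb : y < b by rewrite lt_neqAle yb' andbT; apply/eqP.
have [yc|cy] := leP y c'.
  have : g a < g y by apply: inc => //;
    rewrite in_itv/= ?lexx ?ay ?yc ?(ltW ac).
  have /segmentP/andP[aga _] : [set` J] (g a) by apply: unimodal_maps => //;
    rewrite in_itv/= lexx ltW.
  by rewrite gy ltNge aga.
have : g b < g y by apply: dec => //;
  rewrite in_itv/= ?lexx ?(ltW cy) ?yb' ?(ltW cb).
have /segmentP/andP[agb _] : [set` J] (g b) by apply: unimodal_maps => //;
  rewrite in_itv/= lexx ltW.
by rewrite gy ltNge agb.
Qed.

End Unimodal.
End Segment.

(** * Distance to a set *)

Section Distance.
Context {R : realType}.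
Implicit Types (X Y : set R) (x y : R).

Lemma dist_asym_set1 x Y : dist_asym [set x] Y = inf [set `|x - y| | y in Y].
Proof. by rewrite /dist_asym image_set1 sup1. Qed.

Lemma dist_asym_set1_ge0 x Y : 0 <= dist_asym [set x] Y.
Proof.
rewrite dist_asym_set1; have [->|/set0P Y0] := eqVneq Y set0.
  by rewrite image_set0 inf0.
apply: lb_le_inf; first by case: Y0 => y Yy; exists `|x - y|; exists y.
by move=> _ [y _ <-].
Qed.

Lemma dist_asym_set1_le x y Y : Y y -> dist_asym [set x] Y <= `|x - y|.
Proof.
move=> Yy; rewrite dist_asym_set1; apply: ge_inf; last by exists y.
by exists 0 => _ [z _ <-].
Qed.

Lemma dist_asym_set1_lt x Y (e : R) : Y !=set0 -> dist_asym [set x] Y < e ->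
  exists2 y, Y y & `|x - y| < e.
Proof.
rewrite dist_asym_set1 => -[y0 Yy0] /inf_lt[|_ [y Yy <-] ye].
  by exists `|x - y0|; exists y0.
by exists y.
Qed.

(** The common bound [M] keeps the distances bounded above, without which
    their supremum would be the default value [0]. *)
Lemma dist_asym_lt X Y (M e : R) x : Y !=set0 ->
  (forall x y, X x -> Y y -> `|x - y| <= M) -> dist_asym X Y < e -> X x ->
  exists2 y, Y y & `|x - y| < e.
Proof.
move=> [y0 Yy0] XYM XYe Xx.
apply: dist_asym_set1_lt; first by exists y0.
apply: le_lt_trans XYe; rewrite dist_asym_set1 /dist_asym.
apply: ub_le_sup; last by exists x.
exists M => _ [z Xz <-]; apply: le_trans (XYM _ _ Xz Yy0).
by rewrite -dist_asym_set1; exact: dist_asym_set1_le.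
Qed.

Lemma dist_hausdorff_lt X Y (M e : R) : X !=set0 -> Y !=set0 ->
  (forall x y, X x -> Y y -> `|x - y| <= M) -> dist_hausdorff X Y < e ->
  (forall x, X x -> exists2 y, Y y & `|x - y| < e) /\
  (forall y, Y y -> exists2 x, X x & `|x - y| < e).
Proof.
move=> X0 Y0 XYM; rewrite /dist_hausdorff gt_max => /andP[XYe YXe].
split=> [x|y Yy]; first exact: (dist_asym_lt (M := M)).
have [|x Xx xy] := dist_asym_lt (M := M) X0 _ YXe Yy.
  by move=> u v Yu Xv; rewrite distrC; exact: XYM.
by exists x => //; rewrite distrC.
Qed.

End Distance.

(** * Stable cycles are attractors *)

Section StableOrbit.
Context {R : realType} (J : set R) (g : R -> R).
Hypothesis gJ : forall x, J x -> J (g x).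
Hypothesis gc : forall x, J x -> g y @[y --> within J (nbhs x)] --> g x.

Let itJ n x : J x -> J (iter n g x).
Proof. by move=> Jx; elim: n => //= n; exact: gJ. Qed.

Let itc n x : J x -> iter n g y @[y --> within J (nbhs x)] --> iter n g x.
Proof.
move=> Jx; elim: n => [|n IH]; first exact: cvg_within.
apply: (@cvg_comp _ _ _ (iter n g) g _ (within J (nbhs (iter n g x)))).
  apply: (cvg_to_within (D := J)) => //; first exact: near_withinT.
  by move=> y; exact: itJ.
by apply: gc; exact: itJ.
Qed.

Context (k : nat) (p l : R).
Hypotheses (k0 : (0 < k)%N) (Jp : J p) (gp : iter k g p = p).
Hypotheses (gd : caratheodory J (iter k g) p l) (l1 : `|l| < 1).

Local Notation G := (iter k g).

(** Near [p] the slope of [iter k g] is bounded by some [q < 1], so that the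
    distance to [p] decreases geometrically. *)
Lemma contraction_basin : exists2 d : R, 0 < d &
  forall y, J y -> `|y - p| < d -> iter n G y @[n --> \oo] --> p.
Proof.
have [phi Gphi phil] := gd.
pose q := (1 + `|l|) / 2.
have lq : `|l| < q by move: l1; rewrite /q => l1'; lra.
have q0 : 0 <= q by rewrite (le_trans _ (ltW lq)).
have q1 : q < 1 by move: l1; rewrite /q => l1'; lra.
have : \forall y \near within J (nbhs p), `|phi y| < q.
  exact: cvgr_lt (cvg_norm phil) _ lq.
move=> H; have {H} : nbhs p [set y | J y -> `|phi y| < q] := H.
move/nbhs_ballP => [d /= d0 dq]; exists d => // y Jy yd.
have itG n : J (iter n G y) /\ `|iter n G y - p| <= q ^+ n * `|y - p|.
  elim: n => [|n [Jn IH]]; first by rewrite expr0 mul1r.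
  split; first exact: itJ.
  rewrite iterS -[X in _ - X]gp Gphi// normrM exprS -mulrA ler_pM//.
  apply/ltW/dq => //; rewrite /ball/= distrC (le_lt_trans IH)//.
  by rewrite (le_lt_trans _ yd)// ler_piMl// exprn_ile1// ltW.
have lim0 : q ^+ n * `|y - p| @[n --> \oo] --> (0 : R).
  rewrite -[X in _ --> X](mul0r `|y - p|); apply: cvgM; last exact: cvg_cst.
  by apply: cvg_expr; rewrite ger0_norm.
apply/cvgrPdist_lt => e e0.
have /cvgrPdist_lt/(_ e e0) := lim0.
apply: filterS => n; rewrite sub0r normrN => ne.
rewrite distrC (le_lt_trans (itG n).2)// (le_lt_trans _ ne)//.
by rewrite ler_norm.
Qed.

Local Notation A := (range (fun n => iter n g p)).

Lemma iter_mulnD n i y : iter (n * k + i) g y = iter i g (iter n G y).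
Proof.
rewrite addnC iterD; congr iter.
by elim: n => //= n IH; rewrite mulSn iterD IH.
Qed.

Lemma periodic_iter_mod n : iter n g p = iter (n %% k) g p.
Proof.
rewrite [in LHS](divn_eq n k) iter_mulnD; congr iter.
by elim: (n %/ k)%N => // m IH; rewrite iterS IH.
Qed.

(** A point near the cycle is carried near [p] in at most [k] steps;
    from there the iterates of [iter k g] converge to [p], and the [k]
    continuous maps [iter i g], [i < k], carry this over to all times. *)
Lemma stable_orbit_attractor : attractor J g A.
Proof.
have AJ : A `<=` J by move=> _ [n _ <-]; exact: itJ.
have Ap : A p by exists 0%N.
split => //.
- by exists p.
- apply: finite_compact;
    apply: (@sub_finite_set _ _ ((fun n => iter n g p) @` `I_k)).
    by move=> _ [n _ <-]; rewrite periodic_iter_mod; exists (n %% k)%N => //=;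
      rewrite ltn_mod.
  exact/finite_image/finite_II.
- apply/seteqP; split=> [_ [_ [n _ <-] <-]|_ [n _ <-]]; first by exists n.+1.
  exists (iter (n + k.-1) g p); first by exists (n + k.-1)%N.
  by rewrite -iterS -addnS prednK// iterD gp.
- by exists p; split => //; exact: subset_closure.
have [d d0 basin] := contraction_basin.
have attracted y : J y -> `|y - p| < d ->
    dist_asym [set iter n g y] A @[n --> \oo] --> (0 : R).
  move=> Jy /(basin _ Jy) Gy; apply/cvgrPdist_lt => e e0.
  have near_orbit : \forall z \near within J (nbhs p),
      forall i : 'I_k, `|iter i g p - iter i g z| < e.
    apply: filter_forall => i.
    by have /cvgrPdist_lt := itc (n := i) Jp; apply.
  have /(_ _ near_orbit)[N _ HN] :
      iter n G y @[n --> \oo] --> within J (nbhs p).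
    apply: (cvg_to_within (D := setT)) => //; first exact: filterT.
    by move=> n _; elim: n => //= n; exact: itJ.
  exists (N * k)%N => // n /= Nn.
  rewrite sub0r normrN ger0_norm ?dist_asym_set1_ge0//.
  rewrite (divn_eq n k) iter_mulnD.
  apply: le_lt_trans (dist_asym_set1_le _ (_ : A (iter (n %% k) g p))) _.
    by exists (n %% k)%N.
  rewrite distrC.
  by apply: (HN (n %/ k)%N _ (Ordinal (ltn_pmod n k0))); rewrite /= leq_divRL.
have : \forall r \near (0 : R)^'+, forall i : 'I_k, forall z, J z ->
    `|z - iter i g p| < r -> `|iter (k - i) g z - p| < d.
  apply: filter_forall => i.
  have /cvgrPdist_lt/(_ _ d0) H := itc (n := (k - i)%N) (itJ i Jp).
  have {}H : nbhs (iter i g p) [set z | J z ->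
    `|iter (k - i) g (iter i g p) - iter (k - i) g z| < d] := H.
  move/nbhs_ballP : H => [r /= r0 rP].
  have := nbhs_right_lt r0; apply: filterS => s sr z Jz zs.
  rewrite distrC -[X in `|X - _|]gp -[in iter k g p](subnK (ltnW (ltn_ord i)))
    iterD.
  apply: rP => //; rewrite /ball/= distrC (lt_trans zs sr)//.
move=> H; have [r [r0 rP]] := filter_ex (filterI (nbhs_right_gt (0 : R)) H).
exists r => // x Jx /dist_asym_set1_lt[]; first by exists p.
move=> _ [n _ <-]; rewrite periodic_iter_mod => xr.
have /= xd := rP (Ordinal (ltn_pmod n k0)) _ Jx xr.
rewrite -(cvg_shiftn (k - n %% k)).
have := attracted _ (itJ (k - n %% k)%N Jx) xd.
apply: cvg_trans; apply: near_eq_cvg; near=> m.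
by rewrite /= -iterD.
Unshelve. all: by end_near. Qed.

End StableOrbit.

(** * The saddle-node picture near the bifurcation point *)

Section Crossing.
Context {R : realType}.

(** Where the graph of [g] crosses the diagonal downwards, the mean slope of
    [g] is less than [1] on both sides of the crossing [p].  The sign of the
    second derivative is constant, so [g1] is monotone and [g1 p] lies between
    two such slopes.  The factor [q] allows for either sign. *)
Lemma stable_crossing (D : set R) (g g1 g2 : R -> R) (q u v : R) :
  is_interval D -> D u -> D v ->
  (forall z, D z -> caratheodory D g z (g1 z)) ->
  (forall z, D z -> caratheodory D g1 z (g2 z)) ->
  u < v -> u < g u -> g v < v ->
  (forall z, u < z < v -> 0 < q * g2 z) ->
  exists p, [/\ u < p < v, D p, g p = p & g1 p < 1].
Proof.
move=> Ditv Du Dv gd g1d uv gu gv q2.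
have Duv z : u <= z <= v -> D z by exact: Ditv.
have [p puv gp0] : exists2 p, p \in `[u, v] & g p - p = 0.
  apply: (IVT (f := fun z => g z - z)); first exact: ltW.
    apply: (@continuous_subspaceW _ _ _ D).
      by move=> z /=; rewrite in_itv/=; exact: Duv.
    apply/subspace_continuousP => z Dz; apply: cvgB; last exact: cvg_within.
    exact: caratheodory_continuous (gd _ Dz).
  by rewrite ge_min le_max !subr_le0 !subr_ge0 (ltW gv) (ltW gu) orbT.
have gp : g p = p by apply/eqP; rewrite -subr_eq0 gp0.
move: puv; rewrite in_itv/= !le_eqVlt => /andP[/predU1P[up|up]].
  by move: gu; rewrite up gp ltxx.
case/predU1P => [pv|pv]; first by move: gv; rewrite -pv gp ltxx.
have Dp : D p by apply: Duv; rewrite !ltW.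
exists p; split => //; first by rewrite up.
have [x [/andP[ux xp] Dx gx]] := mean_value_between Ditv Du Dp gd up.
have [y [/andP[py yv] Dy gy]] := mean_value_between Ditv Dp Dv gd pv.
have [z [/andP[xz zp] Dz gz]] := mean_value_between Ditv Dx Dp g1d xp.
have [w [/andP[pw wy] Dw gw]] := mean_value_between Ditv Dp Dy g1d py.
have x1 : g1 x < 1.
  by rewrite -(@ltr_pM2r _ (p - u)) ?subr_gt0// mul1r -gx gp ltrD2l ltrN2.
have y1 : g1 y < 1.
  by rewrite -(@ltr_pM2r _ (v - p)) ?subr_gt0// mul1r -gy gp ltrD2r.
have qz : 0 < q * g2 z by apply: q2; rewrite (lt_trans ux xz) (lt_trans zp pv).
have qw : 0 < q * g2 w by apply: q2; rewrite (lt_trans up pw) (lt_trans wy yv).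
have [q0|q0] := ltP 0 q.
  have w0 : 0 < g2 w by rewrite -(pmulr_rgt0 _ q0).
  apply: lt_trans y1; rewrite -subr_gt0 gw mulr_gt0// subr_gt0//.
have z0 : g2 z < 0.
  rewrite ltNge; apply/negP => z0.
  by move: qz; rewrite ltNge (mulr_le0_ge0 q0 z0).
by apply: lt_trans x1; rewrite -subr_lt0 gz nmulr_rlt0// subr_gt0.
Qed.

End Crossing.

Section SaddleNode.
Context {R : realType} (I J : set R) (G G1 G2 : R -> R -> R) (mu0 x0 L : R).
Hypothesis Jitv : is_interval J.
Hypothesis GC2 : phase_C2 I J G G1 G2.
Hypotheses (Imu0 : nbhs mu0 I) (Jx0 : nbhs x0 J).
Hypotheses (Gx0 : G mu0 x0 = x0) (G1x0 : G1 mu0 x0 = 1).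
Hypotheses (GL : param_slope I J G mu0 x0 L).
Hypotheses (q0 : G2 mu0 x0 != 0) (L0 : L != 0).
Local Notation q := (G2 mu0 x0).
Local Notation near_in mu x := (within (I `*` J) (nbhs (mu, x))).

Let Imu0' : I mu0. Proof. exact: nbhs_singleton. Qed.
Let Jx0' : J x0. Proof. exact: nbhs_singleton. Qed.

Lemma near_box (W : set (R * R)) : near_in mu0 x0 W -> exists2 d : R, 0 < d &
  forall nu x, `|nu - mu0| < d -> `|x - x0| < d -> [/\ I nu, J x & W (nu, x)].
Proof.
move=> WIJ; have {}WIJ : nbhs (mu0, x0) [set p | (I `*` J) p -> W p] := WIJ.
have [[A B] [/= nA nB] AB] := WIJ.
have nAI : nbhs mu0 (A `&` I) by exact: filterI.
have nBJ : nbhs x0 (B `&` J) by exact: filterI.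
move: nAI nBJ => /nbhs_ballP[d /= d0 dP] /nbhs_ballP[e /= e0 eP].
exists (Num.min d e) => [|nu x]; first by rewrite lt_min d0.
rewrite !lt_min => /andP[nud _] /andP[_ xe].
have [Anu Inu] : (A `&` I) nu by apply: dP; rewrite /ball/= distrC.
have [Bx Jx] : (B `&` J) x by apply: eP; rewrite /ball/= distrC.
by split => //; apply: (AB (nu, x)).
Qed.

(** A neighbourhood on which the signs of all quantities that matter are those
    at the bifurcation point; [r] compares the difference quotient in the
    parameter with its limit [L]. *)
Lemma saddle_node_box : exists2 d : R, 0 < d &
  forall nu x, `|nu - mu0| < d -> `|x - x0| < d ->
  [/\ I nu, J x, 0 < q * G2 nu x, 0 < G1 nu x &
      exists2 r : R, 0 < r &
        q * (G nu x - G mu0 x) = r * (q * L * (nu - mu0))].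
Proof.
have [psi Gpsi psiL] := GL.
have q2 : 0 < q * q by rewrite -expr2 exprn_even_gt0//= q0.
have nearG2 : near_in mu0 x0 [set p | 0 < q * G2 p.1 p.2].
  have H : q * G2 p.1 p.2 @[p --> near_in mu0 x0] --> q * q.
    by apply: cvgM; [exact: cvg_cst|exact: (phase_C2_derive2_continuous GC2)].
  exact: cvgr_gt H _ q2.
have nearG1 : near_in mu0 x0 [set p | 0 < G1 p.1 p.2].
  have H : G1 p.1 p.2 @[p --> near_in mu0 x0] --> (1 : R).
    by rewrite -G1x0; exact: (phase_C2_derive_continuous GC2).
  exact: cvgr_gt H _ ltr01.
have nearpsi : near_in mu0 x0 [set p | 0 < psi p / L].
  have H : psi p / L @[p --> near_in mu0 x0] --> (1 : R).
    by rewrite -(divff L0); apply: cvgM => //; exact: cvg_cst.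
  exact: cvgr_gt H _ ltr01.
have [d d0 dP] := near_box (filterI nearG2 (filterI nearG1 nearpsi)).
exists d => // nu x nud xd; have [Inu Jx [/= ? [? rpos]]] := dP nu x nud xd.
split => //; exists (psi (nu, x) / L) => //.
rewrite (Gpsi (nu, x))//=; field; exact: L0.
Qed.

Lemma mean_valueG nu x y : I nu -> J x -> J y -> exists2 t, 0 < t < 1 &
  J (x + t * (y - x)) /\
  G nu y - G nu x = G1 nu (x + t * (y - x)) * (y - x).
Proof.
move=> Inu Jx Jy; have gd z (Jz : J z) := phase_C2_derive GC2 Inu Jz.
by have [t [t01 Jt gt]] := mean_value_within Jitv Jx Jy gd; exists t.
Qed.

Lemma mean_valueG1 nu x y : I nu -> J x -> J y -> exists2 t, 0 < t < 1 &
  J (x + t * (y - x)) /\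
  G1 nu y - G1 nu x = G2 nu (x + t * (y - x)) * (y - x).
Proof.
move=> Inu Jx Jy; have gd z (Jz : J z) := phase_C2_derive2 GC2 Inu Jz.
by have [t [t01 Jt gt]] := mean_value_within Jitv Jx Jy gd; exists t.
Qed.

(** At [mu0] the graph touches the diagonal from one side: two applications of
    the mean value theorem write [G mu0 x - x] as a positive multiple of
    [G2 mu0 z * (x - x0) ^+ 2] with [z] between [x0] and [x]. *)
Lemma saddle_node_tangency : exists2 d : R, 0 < d &
  forall x, `|x - x0| < d -> x != x0 -> 0 < q * (G mu0 x - x).
Proof.
have [d d0 dP] := saddle_node_box; exists d => // x xd xx0.
have mud : `|mu0 - mu0| < d by rewrite subrr normr0.
have [_ Jx _ _ _] := dP _ _ mud xd.
have [t /andP[t0 t1] [Jt Gt]] := mean_valueG Imu0' Jx0' Jx.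
have [s /andP[s0 s1] [Js G1s]] := mean_valueG1 Imu0' Jx0' Jt.
have e : x0 + t * (x - x0) - x0 = t * (x - x0) by ring.
rewrite Gx0 in Gt; rewrite G1x0 e in G1s.
have st1 : s * t <= 1 by rewrite mulr_ile1// ltW.
have xsd : `|x0 + s * (t * (x - x0)) - x0| < d.
  have -> : x0 + s * (t * (x - x0)) - x0 = s * t * (x - x0) by ring.
  rewrite normrM (le_lt_trans _ xd)// ler_piMl//.
  by rewrite ger0_norm// mulr_ge0// ltW.
have [_ _ q2 _ _] := dP _ _ mud xsd.
have -> : q * (G mu0 x - x) =
    q * G2 mu0 (x0 + s * (t * (x - x0))) * (t * (x - x0) ^+ 2).
  have -> : G mu0 x - x = (G1 mu0 (x0 + t * (x - x0)) - 1) * (x - x0).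
    by rewrite mulrBl -Gt; ring.
  by rewrite G1s; ring.
apply: mulr_gt0 => //; apply: mulr_gt0 => //.
by rewrite exprn_even_gt0//= subr_eq0.
Qed.

Lemma saddle_node_no_fixpoint : exists2 d : R, 0 < d &
  forall nu x, `|nu - mu0| < d -> `|x - x0| < d -> 0 < q * L * (nu - mu0) ->
    0 < q * (G nu x - x).
Proof.
have [d d0 dP] := saddle_node_box.
have [e e0 eP] := saddle_node_tangency.
exists (Num.min d e) => [|nu x]; first by rewrite lt_min d0.
rewrite !lt_min => /andP[nud _] /andP[xd xe] nu0.
have [_ _ _ _ [r r0 rE]] := dP _ _ nud xd.
have : 0 <= q * (G mu0 x - x).
  have [->|xx0] := eqVneq x x0; last exact/ltW/eP.
  by rewrite Gx0 subrr mulr0.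
have : 0 < q * (G nu x - G mu0 x) by rewrite rE mulr_gt0.
by move: q => q'; rewrite !mulrBr; lra.
Qed.

(** The displacement [G mu x - x] takes the sign of [q] at a point [y] next to
    [x0], by tangency, and for [mu] on the appropriate side of [mu0] the
    opposite sign at [x0].  Of the two zeros so produced on either side of [x0],
    the stable one is where the displacement decreases; this is why [y] lies
    to the left of [x0] if [q > 0] and to the right if [q < 0]. *)
Lemma saddle_node_stable_fixpoint (e : R) : 0 < e -> exists mu p,
  [/\ `|mu - mu0| < e, `|p - x0| < e, I mu /\ J p, G mu p = p &
      `|G1 mu p| < 1].
Proof.
move=> e0; have [d d0 dP] := saddle_node_box.
have [d' d'0 d'P] := saddle_node_tangency.
pose m := Num.min e (Num.min d d').
have m0 : 0 < m by rewrite !lt_min e0 d0.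
have [me md md'] : [/\ m <= e, m <= d & m <= d'].
  by rewrite !ge_min !lexx !orbT.
pose y := x0 - Num.sg q * (m / 2).
have yx0 : y - x0 = - (Num.sg q * (m / 2)) by rewrite /y; ring.
have ym : `|y - x0| < m.
  rewrite yx0 normrN normrM normr_sg q0 mul1r ger0_norm; lra.
have yNx0 : y != x0.
  by rewrite -subr_eq0 yx0 oppr_eq0 mulf_neq0 ?sgr_eq0//; lra.
have qy : 0 < q * (G mu0 y - y) by apply: d'P => //; exact: lt_le_trans md'.
have mud0 : `|mu0 - mu0| < d by rewrite subrr normr0.
have yd : `|y - x0| < d by exact: lt_le_trans md.
have [_ Jy _ _ _] := dP _ _ mud0 yd.
have [t t0 tP] : exists2 t : R, 0 < t & forall mu, I mu -> `|mu - mu0| < t ->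
    0 < q * (G mu y - y).
  have cy : q * (G mu y - y) @[mu --> within I (nbhs mu0)] -->
            q * (G mu0 y - y).
    apply: cvgM; first exact: cvg_cst.
    apply: cvgB; last exact: cvg_cst.
    apply: (@cvg_comp _ _ _ (fun mu => (mu, y)) (fun p => G p.1 p.2));
      last first.
      exact: phase_C2_continuous GC2 _ _ Imu0' Jy.
    apply: (cvg_to_within (D := I)) => //; first exact: near_withinT.
    apply: (cvg_pair (G := nbhs mu0) (H := nbhs y)); last exact: cvg_cst.
    exact: cvg_within.
  have H : nbhs mu0 [set mu | I mu -> 0 < q * (G mu y - y)].
    exact: cvgr_gt cy _ qy.
  move/nbhs_ballP : H => [t /= t0 tP]; exists t => // mu Imu mut.
  by apply: tP => //; rewrite /ball/= distrC.
pose w := Num.min m t.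
have w0 : 0 < w by rewrite lt_min m0.
have [wm wt] : w <= m /\ w <= t by split; rewrite ge_min lexx ?orbT.
(* This choice makes [q * L * (mu - mu0)] negative. *)
pose mu := mu0 - Num.sg (q * L) * (w / 2).
have qL0 : q * L != 0 by rewrite mulf_neq0.
have mumu0 : mu - mu0 = - (Num.sg (q * L) * (w / 2)) by rewrite /mu; ring.
have muw : `|mu - mu0| < w.
  rewrite mumu0 normrN normrM normr_sg qL0 mul1r ger0_norm; lra.
have mud : `|mu - mu0| < d by rewrite (lt_le_trans muw)// (le_trans wm).
have x0d : `|x0 - x0| < d by rewrite subrr normr0.
have [Imu _ _ _ [r r0 rE]] := dP _ _ mud x0d.
have qx0 : q * (G mu x0 - x0) < 0.
  rewrite -[X in _ - X]Gx0 rE pmulr_rlt0//.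
  have -> : q * L * (mu - mu0) = - (`|q * L| * (w / 2)).
    by rewrite mumu0 normrEsg; ring.
  by rewrite oppr_lt0 mulr_gt0 ?normr_gt0// divr_gt0.
have {}qy : 0 < q * (G mu y - y) by apply: tP => //; exact: lt_le_trans wt.
have [p [pm Jp Gp Gp1]] : exists p,
    [/\ `|p - x0| < m, J p, G mu p = p & G1 mu p < 1].
  have gd z (Jz : J z) := phase_C2_derive GC2 Imu Jz.
  have g1d z (Jz : J z) := phase_C2_derive2 GC2 Imu Jz.
  have q2 u v : (forall z, u < z < v -> `|z - x0| < m) ->
      forall z, u < z < v -> 0 < q * G2 mu z.
    move=> H z /H zm; have zd : `|z - x0| < d by exact: lt_le_trans md.
    by have [] := dP _ _ mud zd.
  move: q0; rewrite neq_lt => /orP[qn|qp].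
    have yE : y = x0 + m / 2 by rewrite /y ltr0_sg// mulN1r opprK.
    have H z : x0 < z < y -> `|z - x0| < m.
      by rewrite yE => /andP[? ?]; rewrite ger0_norm; lra.
    have [||| |p [puv Jp Gp Gp1]] :=
      stable_crossing (q := q) (u := x0) (v := y) Jitv Jx0' Jy gd g1d.
    - by rewrite yE; lra.
    - by rewrite -subr_gt0 -(nmulr_rlt0 _ qn).
    - by rewrite -subr_lt0 -(nmulr_rgt0 _ qn).
    - exact: q2.
    by exists p; split => //; exact: H.
  have yE : y = x0 - m / 2 by rewrite /y gtr0_sg// mul1r.
  have H z : y < z < x0 -> `|z - x0| < m.
    by rewrite yE => /andP[? ?]; rewrite ltr0_norm; lra.
  have [||| |p [puv Jp Gp Gp1]] :=
    stable_crossing (q := q) (u := y) (v := x0) Jitv Jy Jx0' gd g1d.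
  - by rewrite yE; lra.
  - by rewrite -subr_gt0 -(pmulr_rgt0 _ qp).
  - by rewrite -subr_lt0 -(pmulr_rlt0 _ qp).
  - exact: q2.
  by exists p; split => //; exact: H.
exists mu, p; split => //.
- by rewrite (lt_le_trans muw)// (le_trans wm).
- exact: lt_le_trans me.
have pd : `|p - x0| < d by exact: lt_le_trans md.
by have [_ _ _ G1pos _] := dP _ _ mud pd; rewrite gtr0_norm.
Qed.

End SaddleNode.

(** * The iterates of the family *)

Section Family.
Context {R : realType} (I : set R) (a b : R) (f : R -> R -> R).
Hypotheses (I_itv : is_interval I) (ltab : a < b).
Hypothesis f_unimodal : forall mu, I mu -> unimodal a b (f mu).
Hypothesis f_smooth : C2_C1_family I `[a, b] f.
Local Notation J := [set` `[a, b]].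

Lemma family_maps_phase : maps_phase I J f.
Proof. by move=> mu x Imu Jx; exact: (unimodal_maps (f_unimodal Imu)). Qed.

Lemma family_phase_C2 : phase_C2 I J f (fun mu => derive_within J (f mu))
  (fun mu => derive_within J (derive_within J (f mu))).
Proof.
case: f_smooth => fc fd f1c fd2 f2c _ _; split.
- by move=> mu x Imu Jx; apply: caratheodory_derive_within; exact: fd.
- by move=> mu x Imu Jx; apply: caratheodory_derive_within; exact: fd2.
- exact: jointly_continuous_within fc.
- exact: (jointly_continuous_within (h := fun mu =>
    derive_within J (f mu))) f1c.
- exact: (jointly_continuous_within
    (h := fun mu => derive_within J (derive_within J (f mu)))) f2c.
Qed.

(** The nondegeneracy conditions speak of derivatives of the iterate taken as
    limits; they are identified here with the jointly continuous derivatives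
    that the chain rule provides. *)
Lemma saddle_node_iterate k mu0 : nbhs mu0 I -> (1 < k)%N ->
  saddle_node I J f k mu0 -> exists G1 G2 (x0 L : R),
  [/\ phase_C2 I J (fun mu => iter k (f mu)) G1 G2,
      nbhs x0 J, least_period (f mu0) k x0, G1 mu0 x0 = 1 &
      [/\ G2 mu0 x0 != 0, L != 0 &
          param_slope I J (fun mu => iter k (f mu)) mu0 x0 L]].
Proof.
move=> nI k1 [x0 [Jx0 per d1 d2 dmu]].
have Imu0 : I mu0 by exact: nbhs_singleton.
have Jitv : is_interval J by exact: interval_is_interval.
have [G1 [G2 GC2]] := phase_C2_iter k family_maps_phase family_phase_C2.
have dG x : J x -> derive_within J (iter k (f mu0)) x = G1 mu0 x.
  move=> Jx; apply: (segment_derive_within ltab Jx).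
  exact: (phase_C2_derive GC2).
have [L GL] : exists L, param_slope I J (fun mu => iter k (f mu)) mu0 x0 L.
  apply: (param_slope_iter (fm := fun mu x => derive_within I (f^~ x) mu))
    family_phase_C2 _ _ => //.
  - exact: family_maps_phase.
  - move=> mu x Imu Jx; apply: caratheodory_derive_within.
    exact: (family_derivable_param f_smooth).
  - apply: (jointly_continuous_within
      (h := fun mu x => derive_within I (fun nu => f nu x) mu)).
    exact: (family_derive_param_continuous f_smooth).
have G1x0 : G1 mu0 x0 = 1 by rewrite -dG.
exists G1, G2, x0, L; split => //.
- have gd x (Jx : J x) := phase_C2_derive family_phase_C2 Imu0 Jx.
  have : a < x0 < b.
    apply: (periodic_point_interior ltab (f_unimodal Imu0) gd k1 Jx0 per).
    by rewrite -G1x0; exact: (phase_C2_derive GC2).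
  move=> x0ab; near=> y.
  suff : y \in `]a, b[ by rewrite /= !in_itv/= => /andP[/ltW -> /ltW ->].
  by near: y; apply: near_in_itvoo; rewrite in_itv.
- split=> //.
    suff G2E : derive_within J (derive_within J (iter k (f mu0))) x0 = G2 mu0
      x0.
      by apply/eqP; rewrite -G2E.
    apply: (segment_derive_within ltab Jx0).
    apply: (caratheodory_congr (g := G1 mu0)) => //.
      by move=> y /[!inE] Jy; rewrite dG.
    exact: (phase_C2_derive2 GC2).
  suff LE : derive_within I (fun mu => iter k (f mu) x0) mu0 = L.
    by apply/eqP; rewrite -LE.
  apply: derive_within_caratheodory; first exact: dnbhs_within_proper.
  exact: (param_slope_caratheodory Imu0 Jx0 GL).
Unshelve. all: by end_near. Qed.

Lemma stable_cycle_attractor k mu p l : I mu -> J p -> (0 < k)%N ->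
  iter k (f mu) p = p -> caratheodory J (iter k (f mu)) p l -> `|l| < 1 ->
  attractor J (f mu) (range (fun n => iter n (f mu) p)).
Proof.
move=> Imu Jp k0 kp kd l1.
apply: (stable_orbit_attractor _ _ k0 Jp kp kd l1).
  by move=> x; exact: family_maps_phase.
move=> x Jx; apply: caratheodory_continuous.
exact: (phase_C2_derive family_phase_C2).
Qed.

End Family.

(** * Discontinuity of the attractor *)

(** The point of [S] that is extreme in the direction of the drift would be
    moved out of [S]. *)
Lemma drift_no_compact_invariant (R : realType) (S : set R) (g : R -> R)
    (q : R) : compact S -> S !=set0 ->
  (forall x, S x -> S (g x)) -> ~ (forall x, S x -> 0 < q * (g x - x)).
Proof.
move=> cS S0 Sg drift.
have [|m mS mmax] := @compact_EVT_max _ _ (fun x => q * x) S S0 cS.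
  by apply: continuous_subspaceT => x; apply: cvgM => //; exact: cvg_cst.
rewrite inE in mS; have := drift _ mS; rewrite mulrBr subr_gt0 ltNge.
by rewrite mmax// inE; exact: Sg.
Qed.

Theorem lemma4p1 (R : realType) (I : set R) (a b : R) (f : R -> R -> R)
    (A : R -> set R)
    (I_itv : is_interval I) (I_closed : closed I) (ltab : a < b)
    (f_unimodal : forall mu, I mu -> unimodal a b (f mu))
    (f_smooth : C2_C1_family I `[a, b] f)
    (A_attractor : forall mu, I mu -> attractor `[a, b] (f mu) (A mu))
    (A_unique : forall mu B, I mu -> attractor `[a, b] (f mu) B -> B = A mu)
    (mu0 : R) (k : nat) (mu0_int : interior I mu0) (k_gt1 : (1 < k)%N)
    (f_saddle : saddle_node I `[a, b] f k mu0) :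
  ~ hausdorff_continuous_at I A mu0.
Proof.
move=> A_cont; have nI : nbhs mu0 I := mu0_int.
have Imu0 : I mu0 by exact: nbhs_singleton.
have k0 : (0 < k)%N by exact: ltnW.
have [G1 [G2 [x0 [L [GC2 nJ [_ kx0 x0_least] G1x0 [q0 L0 GL]]]]]] :=
  saddle_node_iterate I_itv ltab f_unimodal f_smooth nI k_gt1 f_saddle.
set J := [set` `[a, b]] in GC2 nJ GL.
pose G mu := iter k (f mu).
have Jitv : is_interval J by exact: interval_is_interval.
have Jx0 : J x0 by exact: nbhs_singleton.
have fJ : maps_phase I J f by exact: family_maps_phase.
have fC2 := family_phase_C2 f_smooth.
have itc j : jointly_continuous I J (fun mu => iter j (f mu)).
  by have [h1 [h2 hC2]] := phase_C2_iter j fJ fC2;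
    exact: phase_C2_continuous hC2.
pose F := within (I `*` J) (nbhs (mu0, x0)).
have FF : Filter F by exact: within_filter.
have close j e : 0 < e ->
    F [set p | `|iter j (f p.1) p.2 - iter j (f mu0) x0| < e].
  move=> e0; have /cvgrPdist_lt/(_ _ e0) := itc j _ _ Imu0 Jx0.
  by apply: (@filterS _ F FF) => p /=; rewrite distrC.
(* A radius that separates [x0] from the other points of its cycle. *)
have [eta eta0 eta_sep] : exists2 eta : R, 0 < eta & forall j : 'I_k,
    `|iter j (f mu0) x0 - x0| < eta -> j = 0%N :> nat.
  have : \forall r \near (0 : R)^'+, forall j : 'I_k,
      `|iter j (f mu0) x0 - x0| < r -> j = 0%N :> nat.
    apply: filter_forall => j; have [->|j0] := eqVneq (val j) 0%N.
      by apply: nearW => r _.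
    have xj : 0 < `|iter j (f mu0) x0 - x0|.
      rewrite normr_gt0 subr_eq0; apply/eqP; apply: x0_least.
      by rewrite lt0n j0 ltn_ord.
    have := nbhs_right_lt xj; apply: filterS => r rx xr.
    by have := lt_trans rx xr; rewrite ltxx.
  move=> H; have [r [r0 rP]] := filter_ex (filterI (nbhs_right_gt (0 : R)) H).
  by exists r.
have [d d0 dP] := saddle_node_no_fixpoint Jitv GC2 nI nJ kx0 G1x0 GL q0 L0.
have e2 : 0 < eta / 2 by rewrite divr_gt0.
have [c c0 cP] := near_box nI nJ (close k _ e2).
pose m := Num.min eta (Num.min c d).
have m0 : 0 < m by rewrite !lt_min eta0 c0.
have [me mc md] : [/\ m <= eta, m <= c & m <= d].
  by split; rewrite !ge_min lexx ?orbT.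
(* Since [rho + eta / 2 <= eta], if a point is within [rho] of a cycle
   point and within [eta / 2] of [x0], then that cycle point is [x0]. *)
pose rho := m / 2.
have rho0 : 0 < rho by rewrite divr_gt0.
have rm : rho < m by rewrite /rho; lra.
have r3 : 0 < rho / 3 by rewrite divr_gt0.
have H : F [set p | forall j : 'I_k,
    `|iter j (f p.1) p.2 - iter j (f mu0) x0| < rho / 3].
  exact: (@filter_forall _ 'I_k
    (fun j p => `|iter j (f p.1) p.2 - iter j (f mu0) x0| < rho / 3)
    F FF (fun j => close j _ r3)).
have [c' c'0 c'P] := near_box nI nJ H.
have [delta delta0 deltaP] := A_cont _ r3.
have e0 : 0 < Num.min delta (Num.min c' (rho / 3)).
  by rewrite !lt_min delta0 c'0.
have [mu [p [+ + [Imu Jp] Gp Gp1]]] :=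
  saddle_node_stable_fixpoint Jitv GC2 nI nJ kx0 G1x0 GL q0 L0 e0.
rewrite !lt_min => /and3P[mudelta muc' _] /and3P[_ pc' prho].
(* The side of [mu0] with the stable cycle. *)
have Amu : range (fun n => iter n (f mu) p) = A mu.
  apply: A_unique => //.
  apply: (stable_cycle_attractor f_unimodal f_smooth Imu Jp k0 Gp _ Gp1).
  exact: (phase_C2_derive GC2).
(* The side of [mu0] without fixed points near [x0]. *)
pose t := Num.min delta m.
have t0 : 0 < t by rewrite lt_min delta0.
pose nu := mu0 + Num.sg (G2 mu0 x0 * L) * (t / 2).
have qL0 : G2 mu0 x0 * L != 0 by rewrite mulf_neq0.
have nu_mu0 : nu - mu0 = Num.sg (G2 mu0 x0 * L) * (t / 2) by rewrite /nu; ring.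
have : `|nu - mu0| < t.
  by rewrite nu_mu0 normrM normr_sg qL0 mul1r ger0_norm; lra.
rewrite lt_min => /andP[nudelta num].
have nu_side : 0 < G2 mu0 x0 * L * (nu - mu0).
  rewrite nu_mu0 mulrA [_ * Num.sg _]mulrC -normrEsg.
  by rewrite mulr_gt0 ?normr_gt0// divr_gt0.
have nuc : `|nu - mu0| < c by exact: lt_le_trans mc.
have nud : `|nu - mu0| < d by exact: lt_le_trans md.
have Inu : I nu by have [] := cP nu x0 nuc; rewrite ?subrr ?normr0.
have bounded mu1 mu2 x y : I mu1 -> I mu2 -> A mu1 x -> A mu2 y ->
    `|x - y| <= b - a.
  move=> Imu1 Imu2 /(attractor_sub (A_attractor _ Imu1)) /segmentP/andP[ax xb].
  move=> /(attractor_sub (A_attractor _ Imu2)) /segmentP/andP[ay yb].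
  by rewrite ler_norml; apply/andP; split; lra.
have hausdorff nu' : I nu' -> `|nu' - mu0| < delta ->
    (forall x, A mu0 x -> exists2 y, A nu' y & `|x - y| < rho / 3) /\
    (forall y, A nu' y -> exists2 x, A mu0 x & `|x - y| < rho / 3).
  move=> Inu' nu'delta; apply: (dist_hausdorff_lt (M := b - a)).
  - exact: attractor_nonempty (A_attractor _ Imu0).
  - exact: attractor_nonempty (A_attractor _ Inu').
  - by move=> x y; exact: bounded.
  - by apply: deltaP => //; rewrite distrC.
have [mu0_to_mu mu_to_mu0] := hausdorff _ Imu mudelta.
have [mu0_to_nu nu_to_mu0] := hausdorff _ Inu nudelta.
have A_nu_close z : A nu z -> exists j : 'I_k, `|z - iter j (f mu0) x0| < rho.
  move=> /nu_to_mu0[y /mu0_to_mu[w]]; rewrite -Amu => -[n _ <-].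
  rewrite (periodic_iter_mod Gp) => yw yz.
  exists (Ordinal (ltn_pmod n k0)).
  have [_ _ /(_ (Ordinal (ltn_pmod n k0)))/= xw] := c'P mu p muc' pc'.
  set u := iter _ (f mu) p in yw xw.
  set v := iter _ (f mu0) x0 in xw *.
  have -> : z - v = - (y - z) + (y - u) + (u - v) by ring.
  apply: le_lt_trans (ler_normD _ _) _.
  apply: le_lt_trans (lerD (ler_normD _ _) (lexx _)) _.
  by rewrite normrN; lra.
have A_nu_iter z : A nu z -> A nu (G nu z).
  have fA z' : A nu z' -> A nu (f nu z').
    move=> Az'; rewrite -[X in X _](attractor_invariant (A_attractor _ Inu)).
    by exists z'.
  by rewrite /G; elim: (k) => //= n IH /IH; exact: fA.
pose S := A nu `&` [set` `[x0 - rho, x0 + rho]].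
have SP z : S z <-> A nu z /\ `|z - x0| <= rho.
  by rewrite /S /= in_itv/= ler_distl.
have closeS z : S z -> `|z - x0| < m by move=> /SP[_ zrho];
  exact: le_lt_trans rm.
(* The part of [A nu] near [x0] is invariant: its image under [G nu] is near
  [x0]
   and near the cycle, hence within [rho] of [x0] itself. *)
apply: (@drift_no_compact_invariant _ S (G nu) (G2 mu0 x0)).
- apply: compact_closedI; last exact: interval_closed.
  exact: attractor_compact (A_attractor _ Inu).
- have Ap : A mu p by rewrite -Amu; exists 0%N.
  have [y /mu0_to_nu[z Az yz] yp] := mu_to_mu0 _ Ap.
  exists z; apply/SP; split => //.
  have -> : z - x0 = - (y - z) + (y - p) + (p - x0) by ring.
  apply: le_trans (ler_normD _ _) _.
  apply: le_trans (lerD (ler_normD _ _) (lexx _)) _.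
  by rewrite normrN; lra.
- move=> z Sz; have [Az _] := (SP z).1 Sz; apply/SP; split;
    first exact: A_nu_iter.
  have [j Gzj] := A_nu_close _ (A_nu_iter _ Az).
  have zc : `|z - x0| < c by exact: lt_le_trans (closeS _ Sz) mc.
  have [_ _ /=] := cP nu z nuc zc; rewrite kx0 => Gz.
  suff j0 : j = 0%N :> nat by move: Gzj; rewrite j0 => /ltW.
  apply: eta_sep; rewrite distrC.
  set v := iter j (f mu0) x0 in Gzj *.
  have -> : x0 - v = - (G nu z - x0) + (G nu z - v) by ring.
  apply: le_lt_trans (ler_normD _ _) _.
  by rewrite normrN; move: Gz Gzj me; rewrite /G /rho; lra.
- move=> z Sz; apply: dP => //.
  exact: lt_le_trans (closeS _ Sz) md.
Qed.
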